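(* Let $\mathcal{G}$ be an $n$-cell coupled cell network with symbolic adjacency matrix $A$ and total phase space $\mathbb{R}^n$. Let $\bowtie$ be an equivalence relation on the set of cells $\mathcal{C}$, with $k$ equivalence classes, let $P_{\bowtie}$ be the associated block diagonal projection matrix, and let $A=(A_{st})_{s,t=1,\dots,k}$ be the block decomposition of $A$ corresponding to the blocks of $P_{\bowtie}$ (rows and columns of $A$ being arranged according to the normal form of $\bowtie$). Then the polydiagonal subspace $\triangle_{\bowtie}$ is a synchrony subspace if and only if each block $A_{st}$, $s,t=1,\dots,k$, of $A$ is a homogeneous block matrix.
   Context: A coupled cell network $\mathcal{G}=(\mathcal{C},\mathcal{E},\sim_C,\sim_E)$ consists of a finite set of cells $\mathcal{C}=\{1,\dots,n\}$, a finite set of arrows $\mathcal{E}$, maps $\mathcal{H},\mathcal{T}:\mathcal{E}\to\mathcal{C}$ (head and tail), and equivalence relations $\sim_C$ on $\mathcal{C}$ (cell type) and $\sim_E$ on $\mathcal{E}$ (arrow type) such that $e\sim_E e'$ implies $\mathcal{H}(e)\sim_C\mathcal{H}(e')$ and $\mathcal{T}(e)\sim_C\mathcal{T}(e')$. Multiple arrows and self-coupling are allowed. The input set of $c$ is $I(c)=\{e\in\mathcal{E}:\mathcal{H}(e)=c\}$. Cells $c,d$ are input isomorphic, $c\sim_I d$, if there is a bijection $\beta:I(c)\to I(d)$ with $e\sim_E\beta(e)$ for all $e\in I(c)$ (such a $\beta$ is called an input isomorphism); if $I(c)=I(d)=\emptyset$, then $c\sim_I d$ iff $c\sim_C d$.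 Symbolic adjacency matrix: let $e_1,\dots,e_m$ be formal symbols, one for each arrow type. $A=(a_{ij})$ is the $n\times n$ matrix with $a_{ij}=\sum_{k=1}^m\beta_k e_k$, where $\beta_k$ is the number of arrows of type $e_k$ from cell $j$ to cell $i$. The symbols are treated as formally independent, so two symbolic entries are equal iff all coefficients agree. Admissible vector fields: the total phase space is $P=\mathbb{R}^n$, with one real variable $x_c$ per cell. A vector field $F=(f_c)_{c\in\mathcal{C}}$ on $P$ is admissible if each component has the form $f_c(x)=\hat f_c\big(x_c,(x_{\mathcal{T}(e)})_{e\in I(c)}\big)$ and, whenever $c\sim_I d$ with input isomorphism $\beta:I(c)\to I(d)$, the functions agree: $\hat f_c\big(y,(z_{\beta(e)})_{e\in I(c)}\big)=\hat f_d\big(y,(z_{e'})_{e'\in I(d)}\big)$ for all $y$ and all $(z_{e'})_{e'\in I(d)}$ (in particular each $\hat f_c$ is symmetric in inputs of the same arrow type). The polydiagonal subspace of an equivalence relation $\bowtie$ on $\mathcal{C}$ is $\triangle_{\bowtie}=\{x\in P: c\bowtie d\Rightarrow x_c=x_d\}$. It is a synchrony subspace if $F(\triangle_{\bowtie})\subseteq\triangle_{\bowtie}$ for every admissible vector field $F$. Normal form, projection and blocks: write $\bowtie$ as a product of disjoint cycles (its classes), each with increasing entries, the cycles ordered by increasing length (ties in any fixed order); arrange rows and columns of $n\times n$ matrices in this order. Let $\pi$ map each cell to the first element of its cycle; $P_{\bowtie}=(p_{ij})$ is the matrix with $p_{i,\pi(i)}=1$ and all other entries $0$. It is block diagonal with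 $k$ diagonal blocks, one for each class, and is a projection onto $\triangle_{\bowtie}$. The block $A_{st}$ of $A$ consists of the entries $a_{ij}$ with $i$ in the $s$-th class and $j$ in the $t$-th class. A $p\times q$ symbolic matrix $B=(b_{ij})$ is a homogeneous block matrix if the row sum $\sum_{j=1}^q b_{ij}$ is the same for all rows $i=1,\dots,p$.
   Formalization: It is additionally assumed that any two ⋈-related cells with empty input sets have the same cell type; without this the ''if'' direction fails (two arrowless cells of different types identified by ⋈, with A = 0). *)

(* Defs.v *)
From HB Require Import structures.
From mathcomp Require Import all_boot all_order all_algebra.
From mathcomp Require Import boolp classical_sets reals.

Set Implicit Arguments.
Unset Strict Implicit.
Unset Printing Implicit Defensive.

Import GRing.Theory.

Local Open Scope ring_scope.

Record network (n : nat) := Network {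
  arrow : finType;
  head : arrow -> 'I_n;
  tail : arrow -> 'I_n;
  cell_type : rel 'I_n;
  arrow_type : rel arrow;
  cell_type_equiv : equivalence_rel cell_type;
  arrow_type_equiv : equivalence_rel arrow_type;
  head_compat : forall e e', arrow_type e e' -> cell_type (head e) (head e');
  tail_compat : forall e e', arrow_type e e' -> cell_type (tail e) (tail e')
}.

Definition input n (G : network n) (c : 'I_n) : finType :=
  {e : arrow G | head e == c}.

Definition input_isomorphism n (G : network n) (c d : 'I_n)
    (beta : input G c -> input G d) : Prop :=
  bijective beta /\ forall e, arrow_type (val e) (val (beta e)).

Definition input_equiv n (G : network n) (c d : 'I_n) : Prop :=
  if (#|input G c| == 0%N) && (#|input G d| == 0%N)
  then is_true (cell_type G c d)
  else exists beta : input G c -> input G d, input_isomorphism beta.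

(* A formal combination of the arrow types [e_k] is the row vector of its
   multiplicities [beta_k]; the [e_k] are the canonical basis vectors, so
   equality is equality of all coefficients. *)
Definition arrow_classes n (G : network n) : {set {set arrow G}} :=
  equivalence_partition (@arrow_type n G) [set: arrow G].

Definition num_arrow_types n (G : network n) : nat := #|arrow_classes G|.

Definition arrow_symbol n (G : network n) (k : 'I_(num_arrow_types G)) :
    'rV[nat]_(num_arrow_types G) := delta_mx 0 k.

Definition arrow_count n (G : network n) (k : 'I_(num_arrow_types G))
    (i j : 'I_n) : nat :=
  #|[set e in (enum_val k : {set arrow G}) | (tail e == j) && (head e == i)]|.

Definition sym_adjacency n (G : network n) :
    'M['rV[nat]_(num_arrow_types G)]_n :=
  \matrix_(i, j) \sum_k arrow_symbol k *+ arrow_count k i j.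

Definition admissible (R : realType) n (G : network n)
    (F : 'cV[R]_n -> 'cV[R]_n) : Prop :=
  exists fhat : forall c, R -> {ffun input G c -> R} -> R,
    (forall (x : 'cV[R]_n) c,
       F x c 0 = fhat c (x c 0) [ffun e => x (tail (val e)) 0]) /\
    (forall c d (beta : input G c -> input G d),
       input_equiv G c d -> input_isomorphism beta ->
       forall y (z : {ffun input G d -> R}),
         fhat c y [ffun e => z (beta e)] = fhat d y z).

Definition polydiagonal (R : realType) n (r : rel 'I_n) : set 'cV[R]_n :=
  [set x | forall c d, r c d -> x c 0 = x d 0]%classic.

Arguments polydiagonal R {n} r.

Definition synchrony_subspace (R : realType) n (G : network n)
    (D : set 'cV[R]_n) : Prop :=
  forall F, admissible G F -> (F @` D `<=` D)%classic.

(* [nf_cell s i] is the i-th entry of the s-th cycle of [r]; cycles of equal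
   length may come in any order, so [r] can have several normal forms. *)
Record normal_form n (r : rel 'I_n) := NormalForm {
  nf_size : nat;
  nf_len : 'I_nf_size -> nat;
  nf_cell : forall s, 'I_(nf_len s) -> 'I_n;
  nf_len_gt0 : forall s, (0 < nf_len s)%N;
  nf_len_mono : forall s t : 'I_nf_size, (s <= t)%N -> (nf_len s <= nf_len t)%N;
  nf_cell_mono : forall s (i j : 'I_(nf_len s)),
    (i < j)%N -> (nf_cell i < nf_cell j)%N;
  nf_cell_rel : forall s t (i : 'I_(nf_len s)) (j : 'I_(nf_len t)),
    r (nf_cell i) (nf_cell j) = (s == t);
  nf_cell_surj : forall c, exists s, exists i : 'I_(nf_len s), nf_cell i = c
}.

Arguments nf_size {n r} nf : rename.
Arguments nf_len {n r} nf s : rename.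
Arguments nf_cell {n r} nf s i : rename.

Definition nf_order n (r : rel 'I_n) (nf : normal_form r)
    (u : 'I_(\sum_s nf_len nf s)) : 'I_n :=
  nf_cell nf (tagnat.sig1 u) (tagnat.sig2 u).

Definition arrange (T : Type) n (r : rel 'I_n) (nf : normal_form r)
    (A : 'M[T]_n) : 'M[T]_(\sum_s nf_len nf s) :=
  mxsub (@nf_order n r nf) (@nf_order n r nf) A.

Definition block (T : Type) n (r : rel 'I_n) (nf : normal_form r)
    (A : 'M[T]_n) (s t : 'I_(nf_size nf)) :
    'M[T]_(nf_len nf s, nf_len nf t) :=
  submxblock (arrange nf A) s t.

Arguments block {T n r} nf A s t.

Definition homogeneous (V : nmodType) p q (B : 'M[V]_(p, q)) : Prop :=
  forall i i' : 'I_p, \sum_j B i j = \sum_j B i' j.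

(* Entries of a cycle increase, so its first element is its least one. *)
Definition class_first n (r : rel 'I_n) (c : 'I_n) : 'I_n :=
  [arg min_(d < c | r c d) val d]%N.

Definition class_proj (R : nzRingType) n (r : rel 'I_n) : 'M[R]_n :=
  \matrix_(i, j) (j == class_first r i)%:R.

Arguments class_proj R {n} r.

Lemma blockE (T : Type) n (r : rel 'I_n) (nf : normal_form r) (A : 'M[T]_n)
    s t i j : block nf A s t i j = A (nf_cell nf s i) (nf_cell nf t j).
Proof.
rewrite /block /arrange !mxE /nf_order.
have E u (k : 'I_(nf_len nf u)) :
    nf_cell nf (tagnat.sig1 (tagnat.Rank u k)) (tagnat.sig2 (tagnat.Rank u k))
    = nf_cell nf u k.
  rewrite tagnat.Rank2K; move: (esym _) => e; move: e.
  set v := tagnat.sig1 _; case: v /.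
  by rewrite cast_ord_id.
by rewrite !E.
Qed.

Lemma class_first_rel n (r : rel 'I_n) (hr : equivalence_rel r) c :
  r c (class_first r c).
Proof. by rewrite /class_first; case: arg_minnP => //; case: (hr c c c). Qed.

Lemma class_first_le n (r : rel 'I_n) (hr : equivalence_rel r) c d :
  r c d -> (class_first r c <= d)%N.
Proof.
by rewrite /class_first; case: arg_minnP => [|m _ h /h//]; case: (hr c c c).
Qed.

Lemma class_first_eq n (r : rel 'I_n) (hr : equivalence_rel r) c d :
  r c d -> class_first r c = class_first r d.
Proof.
move=> cd; have [_ hcd] := hr c d (class_first r c).
have [_ hcd'] := hr c d (class_first r d).
apply/val_inj/eqP; rewrite eqn_leq !class_first_le //.
  by rewrite -hcd // class_first_rel.
by rewrite hcd' // class_first_rel.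
Qed.

Lemma class_proj_mulE (R : nzRingType) n (r : rel 'I_n) (x : 'cV[R]_n) c :
  (class_proj R r *m x) c 0 = x (class_first r c) 0.
Proof.
rewrite mxE (bigD1 (class_first r c)) //= big1 => [|j /negPf hj].
  by rewrite mxE eqxx mul1r addr0.
by rewrite mxE hj mul0r.
Qed.

Lemma class_proj_image (R : realType) n (r : rel 'I_n)
    (hr : equivalence_rel r) :
  range (mulmx (class_proj R r) : 'cV[R]_n -> 'cV[R]_n) = polydiagonal R r.
Proof.
apply/seteqP; split=> [_ [x _ <-] c d cd | x hx].
  by rewrite !class_proj_mulE (class_first_eq hr cd).
exists x => //; apply/matrixP => c j; rewrite ord1 class_proj_mulE.
by apply/esym/hx/class_first_rel.
Qed.

Lemma class_proj_idem (R : realType) n (r : rel 'I_n)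
    (hr : equivalence_rel r) :
  class_proj R r *m class_proj R r = class_proj R r.
Proof.
apply/matrixP => c j; rewrite mxE (bigD1 (class_first r c)) //= big1.
  by rewrite !mxE eqxx mul1r addr0 -(class_first_eq hr (class_first_rel hr c)).
by move=> k /negPf hk; rewrite mxE hk mul0r.
Qed.

Lemma class_proj_blocks (R : nzRingType) n (r : rel 'I_n)
    (hr : equivalence_rel r) (nf : normal_form r) :
  arrange nf (class_proj R r) =
  \mxdiag_(s < nf_size nf)
     (\matrix_(i < nf_len nf s, j < nf_len nf s) (val j == 0%N)%:R).
Proof.
rewrite /mxdiag -[LHS]submxblockK; apply/eq_mxblock => s t.
apply/matrixP => i j; rewrite -/(block nf _ s t) blockE !mxE.
set c := nf_cell nf s i.
have hF := class_first_rel hr c.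
case: (eqVneq s t) => [est | /negPf nst]; last first.
  rewrite mxE; case: eqP => // e.
  by move: hF; rewrite -e nf_cell_rel nst.
case: t / est j => j; rewrite conform_mx_id !mxE.
pose z : 'I_(nf_len nf s) := Ordinal (nf_len_gt0 s).
suff -> : class_first r c = nf_cell nf s z.
  congr ((_ : bool)%:R); apply/eqP/eqP => [e | j0]; last first.
    by congr nf_cell; apply/val_inj.
  case: (posnP j) => // j0; have := nf_cell_mono (i := z) (j := j) j0.
  by rewrite e ltnn.
apply/val_inj/eqP; rewrite eqn_leq class_first_le /=; last first.
- by rewrite nf_cell_rel eqxx.
- exact: hr.
have [t [k ek]] := nf_cell_surj nf (class_first r c).
move: hF; rewrite -ek nf_cell_rel => /eqP est; case: t / est k {ek} => k.
case: (posnP k) => k0; first by rewrite (_ : k = z) //; apply/val_inj.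
by apply: ltnW; apply: nf_cell_mono.
Qed.

Lemma normal_form_exists n (r : rel 'I_n) (hr : equivalence_rel r) :
  inhabited (normal_form r).
Proof.
pose P := equivalence_partition r [set: 'I_n].
have hP : finset.partition P [set: 'I_n].
  by apply: finset.equivalence_partitionP => x y z _ _ _; exact: hr.
have Prel B c d : B \in P -> c \in B -> r c d = (d \in B).
  case/imsetP => x _ ->; rewrite !inE /= => xc.
  by have [_ /(_ xc) <-] := hr x c d.
pose le := [rel A B : {set 'I_n} | #|A| <= #|B|]%N.
have letr : transitive le by move=> A B C; apply: leq_trans.
pose cs := sort le (enum P).
have csP B : (B \in cs) = (B \in P) by rewrite mem_sort mem_enum.
have csU : uniq cs by rewrite sort_uniq enum_uniq.
pose cl (s : 'I_(size cs)) := tnth (in_tuple cs) s.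
have clP s : cl s \in P by rewrite -csP mem_tnth.
have cl_inj : injective cl by apply/tuple_uniqP.
apply: inhabits.
apply: (@NormalForm n r (size cs) (fun s => #|cl s|)
          (fun s i => enum_val i)).
- move=> s; rewrite card_gt0; apply: contraTneq (clP s) => ->.
  by case/and3P: hP.
- move=> s t st; rewrite /cl !(tnth_nth finset.set0).
  have le_total : total le by move=> A B; apply: leq_total.
  apply: (sorted_leq_nth letr (fun A => leqnn #|A|) finset.set0
            (sort_sorted le_total _) s t) => //; exact: ltn_ord.
- move=> s i j ij; set B := cl s in i j ij *.
  have i0 : 'I_n := enum_val i.
  rewrite /enum_val !(set_nth_default i0 (enum_default _)) -?cardE //.
  have lt_tr : transitive (fun x y : 'I_n => (x < y)%N) by move=> x y z; apply: ltn_trans.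
  have srt : sorted (fun x y : 'I_n => (x < y)%N) (enum B).
    rewrite /enum_mem; apply: sorted_filter => //.
    have := iota_ltn_sorted 0 n; rewrite -val_enum_ord sorted_map.
    by rewrite enumT.
  by apply: (sorted_ltn_nth lt_tr i0 srt) => //; rewrite inE -cardE.
- move=> s t i j; rewrite (Prel (cl s)) ?enum_valP //.
  apply/idP/eqP => [h | e]; last by rewrite {1}e enum_valP.
  apply: cl_inj; apply/eqP; apply: contraT => ne.
  have /and3P[_ /finset.trivIsetP tI _] := hP.
  have := disjointFr (tI _ _ (clP s) (clP t) ne) h.
  by rewrite enum_valP.
- move=> c; have cB : c \in finset.pblock P c by rewrite mem_pblock (cover_partition hP) inE.
  have : finset.pblock P c \in cs by rewrite csP pblock_mem // (cover_partition hP) inE.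
  move=> Bcs; have lt := Bcs; rewrite -index_mem in lt; exists (Ordinal lt).
  have cs' : c \in cl (Ordinal lt).
    by rewrite /cl (tnth_nth finset.set0) /= nth_index.
  by exists (enum_rank_in cs' c); rewrite enum_rankK_in.
Qed.

(* Main.v *)
Require Import Defs.
From mathcomp Require Import all_boot all_order all_algebra.
From mathcomp Require Import boolp classical_sets reals.
From mathcomp Require Import perm.

(** The row sum of row [i] of a block [A_st] is a formal combination of arrow
    types whose [k]-th coefficient counts the arrows of type [k] that enter
    [i] from the [t]-th class ([block_row_sumE]).  So all the blocks are
    homogeneous exactly when equivalent cells receive, for each arrow type and
    each class, the same number of arrows of that type from that class
    ([homogeneous_blocksP]); the theorem compares synchrony with this counting
    condition.

    If the counts agree for [c] and [d], the arrows entering [c] can be matched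
    with those entering [d] so that both the arrow type and the class of the
    tail are kept ([matching_of_equal_counts]).  The matching is an input
    isomorphism, so an admissible [F] has [f_c = f_d] up to this reindexing,
    and at a point of the polydiagonal the reindexed inputs coincide, since
    matched tails are equivalent.  Hence [F] preserves the polydiagonal.  If
    neither cell has inputs, the matching is empty and [c], [d] are input
    isomorphic because they have the same cell type.

    Conversely, the field whose component at [c] is the sum of all inputs of
    type [k] is admissible, and its value at the indicator vector of a class,
    which lies in the polydiagonal, is the vector of these counts.
    Invariance therefore forces the counts to agree on each class. *)

Set Implicit Arguments.
Unset Strict Implicit.
Unset Printing Implicit Defensive.

Import GRing.Theory Num.Theory.

Local Open Scope ring_scope.

(** Listing [A] and [B] by the [q]-classes of their labels gives two sequences
    with the same multiplicities, hence permutations of each other; the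
    permutation of positions is the matching. *)
Lemma matching_of_equal_counts (A B E : finType) (q : rel E)
    (f : A -> E) (g : B -> E) :
  equivalence_rel q ->
  (forall e, #|[set a | q e (f a)]| = #|[set b | q e (g b)]|) ->
  exists2 beta : A -> B, bijective beta & forall a, q (f a) (g (beta a)).
Proof.
move=> q_equiv eq_count.
pose cls e := [set e' | q e e'].
have clsE e e' : (cls e' == cls e) = q e e'.
  apply/eqP/idP => [/setP/(_ e') | ee'].
    rewrite !inE; have [-> _] := q_equiv e' e' e'.
    by move=> <-.
  by apply/setP => x; rewrite !inE; have [_ /(_ ee')] := q_equiv e e' x.
have count_codom (T : finType) (h : T -> E) e :
    count_mem (cls e) (codom (cls \o h)) = #|[set a | q e (h a)]|.
  rewrite /codom /image_mem count_map cardsE cardE -size_filter /enum_mem.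
  rewrite -filter_predI; congr size; apply: eq_filter => a.
  by rewrite /= clsE andbT.
have pAB : perm_eq (codom (cls \o f)) (codom_tuple (cls \o g)).
  apply/allP => X; rewrite mem_cat => XAB.
  have [e ->] : exists e, X = cls e.
    by case/orP: XAB => /codomP[a ->]; [exists (f a) | exists (g a)].
  by apply/eqP; rewrite /= !count_codom.
have eqAB : #|A| = #|B|.
  by have := perm_size pAB; rewrite size_tuple size_codom.
have [p pE] := tuple_permP pAB.
exists (fun a => enum_val (p (cast_ord eqAB (enum_rank a)))) => [|a].
  apply: inj_card_bij; last by rewrite eqAB.
  by move=> a a' /enum_val_inj/perm_inj/cast_ord_inj/enum_rank_inj.
set b := enum_val _.
rewrite -clsE; apply/eqP.
have := nth_codom (cls (f a)) (cls \o f) (enum_rank a).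
rewrite enum_rankK /= => <-; rewrite pE.
(* [enum_rank a] indexes the list over [A]; the permuted list has length
   [#|B|], so the same position must be seen as an index there. *)
rewrite (_ : nat_of_ord _ = cast_ord eqAB (enum_rank a)) //.
rewrite -tnth_nth tnth_mktuple.
by rewrite (tnth_nth (cls (f a))) nth_codom.
Qed.

Lemma equivalence_rel_sym (T : Type) (q : rel T) :
  equivalence_rel q -> symmetric q.
Proof.
move=> q_equiv; suff q_sym x y : q x y -> q y x.
  by move=> x y; apply/idP/idP; apply: q_sym.
by have [qxx /[apply] <-] := q_equiv x y x.
Qed.

(** The class of tails is given by one of its members, [j], so that the
    definition does not depend on a numbering of the classes. *)
Definition class_inputs n (G : network n) (r : rel 'I_n)
    (k : 'I_(num_arrow_types G)) (c j : 'I_n) : {set arrow G} :=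
  [set e in (enum_val k : {set arrow G}) | r j (tail e) && (Defs.head e == c)].

Lemma big_input (T : Type) (idx : T) (op : Monoid.com_law idx) n
    (G : network n) (c : 'I_n) (P : pred (arrow G)) (F : arrow G -> T) :
  \big[op/idx]_(e : input G c | P (val e)) F (val e) =
  \big[op/idx]_(e | P e && (Defs.head e == c)) F e.
Proof.
under [RHS]eq_bigl do rewrite andbC.
by exact: esym (big_sub_cond (fun e => Defs.head e == c) P F).
Qed.

Lemma same_arrow_type n (G : network n) (k : 'I_(num_arrow_types G))
    (e e' : arrow G) :
  e \in (enum_val k : {set arrow G}) ->
  (e' \in (enum_val k : {set arrow G})) = arrow_type e e'.
Proof.
have /imsetP[x _ ->] := enum_valP k; rewrite !inE /= => xe.
by have [_ /(_ xe)] := arrow_type_equiv x e e'.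
Qed.

Lemma arrow_in_type n (G : network n) (e : arrow G) :
  exists k : 'I_(num_arrow_types G), e \in (enum_val k : {set arrow G}).
Proof.
have eP : [set e' in [set: arrow G] | arrow_type e e'] \in arrow_classes G.
  exact: imset_f.
exists (enum_rank_in eP [set e' in [set: arrow G] | arrow_type e e']).
rewrite enum_rankK_in // !inE; exact: (arrow_type_equiv e e e).1.
Qed.

(** The entries of the [t]-th cycle enumerate without repetition the class of
    any one of them, so summing over the columns of a block is summing over
    the tails in that class. *)
Lemma block_row_sumE n (G : network n) (r : rel 'I_n) (nf : normal_form r)
    s t i z k :
  (\sum_j block nf (sym_adjacency G) s t i j) 0 k =
  #|class_inputs r k (nf_cell nf s i) (nf_cell nf t z)|.
Proof.
set c := nf_cell nf s i; set d0 := nf_cell nf t z.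
have entryE d : sym_adjacency G c d 0 k = arrow_count k c d.
  rewrite mxE summxE (bigD1 k) //= big1 => [|l lk].
    by rewrite mulmxnE mxE !eqxx addr0 -[RHS]natn.
  by rewrite mulmxnE mxE eqxx eq_sym (negPf lk) mul0rn.
have nf_inj : injective (nf_cell nf t).
  move=> a b ab; apply/val_inj.
  by case: (ltngtP a b) => // /(nf_cell_mono (n := n)); rewrite ab ltnn.
rewrite summxE; under eq_bigr => j _ do rewrite blockE entryE.
have -> : \sum_j arrow_count k c (nf_cell nf t j) =
    (\sum_(d | r d0 d) arrow_count k c d)%N.
  rewrite -(big_imset (arrow_count k c) (A := predT)) /=; last exact: in2W.
  apply: eq_bigl => d; apply/imsetP/idP => [[j _ ->] | d0d].
    by rewrite nf_cell_rel.
  have [u [j dE]] := nf_cell_surj nf d; move: d0d; rewrite -dE nf_cell_rel.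
  by move=> /eqP tu; case: u / tu j {dE} => j; exists j.
rewrite -sum1_card (partition_big (@tail n G) (r d0)) /= => [|e]; last first.
  by rewrite inE => /and3P[].
apply: eq_bigr => d d0d; rewrite /arrow_count -sum1_card.
apply: eq_bigl => e; rewrite !inE -!andbA; case: (e \in _) => //=.
by case: eqP => [->|]; rewrite ?d0d ?andbF ?andbT.
Qed.

(** This removes the normal form: the order of the cycles and of their entries
    does not affect which row sums are compared. *)
Lemma homogeneous_blocksP n (G : network n) (r : rel 'I_n)
    (nf : normal_form r) :
  (forall s t, homogeneous (block nf (sym_adjacency G) s t)) <->
  (forall (k : 'I_(num_arrow_types G)) c d j, r c d ->
     #|class_inputs r k c j| = #|class_inputs r k d j|).
Proof.
split=> [hom k c d j | eq_count s t i i'].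
  have [s [a <-]] := nf_cell_surj nf c; have [u [b <-]] := nf_cell_surj nf d.
  have [t [z <-]] := nf_cell_surj nf j; rewrite nf_cell_rel => /eqP su.
  case: u / su b => b.
  by rewrite -!block_row_sumE // (hom s t a b).
apply/rowP => k; have z := Ordinal (nf_len_gt0 t).
by rewrite !(block_row_sumE _ z) //; apply: eq_count; rewrite nf_cell_rel.
Qed.

Definition input_sum (R : realType) n (G : network n)
    (k : 'I_(num_arrow_types G)) (x : 'cV[R]_n) : 'cV[R]_n :=
  \col_c \sum_(e : input G c | val e \in (enum_val k : {set arrow G}))
     x (tail (val e)) 0.

(** An input isomorphism permutes the summands, since it keeps arrow types. *)
Lemma input_sum_admissible (R : realType) n (G : network n)
    (k : 'I_(num_arrow_types G)) : admissible G (@input_sum R n G k).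
Proof.
exists (fun c _ z => \sum_(e | val e \in (enum_val k : {set arrow G})) z e).
split=> [x c | c d beta _ [beta_bij beta_type] _ z].
  by rewrite mxE; apply: eq_bigr => e _; rewrite ffunE.
rewrite [RHS](reindex beta) /=; last exact: onW_bij.
apply: eq_big => e; last by rewrite ffunE.
by apply/idP/idP => ek; rewrite (same_arrow_type _ ek) ?beta_type //
  (equivalence_rel_sym (@arrow_type_equiv n G)) beta_type.
Qed.

Lemma input_sum_indicator (R : realType) n (G : network n)
    (k : 'I_(num_arrow_types G)) (r : rel 'I_n) (c j : 'I_n) :
  input_sum k (\col_d (r j d)%:R) c 0 = #|class_inputs r k c j|%:R :> R.
Proof.
rewrite mxE (big_input (+%R) _ (fun e => e \in (enum_val k : {set arrow G}))
  (fun e => (\col_d (r j d)%:R : 'cV[R]_n) (tail e) 0)).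
rewrite -sum1_card natr_sum big_mkcond [RHS]big_mkcond; apply: eq_bigr => e _.
by rewrite mxE inE; case: (_ \in _); case: (_ == _); case: (r j _).
Qed.

Theorem theorem3p9 (R : realType) (n : nat) (G : network n) (r : rel 'I_n)
    (r_equiv : equivalence_rel r)
    (r_source : forall c d : 'I_n, r c d ->
       #|input G c| = 0%N -> #|input G d| = 0%N -> cell_type G c d)
    (nf : normal_form r) :
  synchrony_subspace G (polydiagonal R r) <->
  forall s t : 'I_(nf_size nf), homogeneous (block nf (sym_adjacency G) s t).
Proof.
rewrite homogeneous_blocksP //; split=> [sync k c d j cd | eq_count F].
  pose x : 'cV[R]_n := \col_d (r j d)%:R.
  have x_diag : polydiagonal R r x.
    move=> a b ab; rewrite !mxE (equivalence_rel_sym r_equiv).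
    by rewrite (equivalence_rel_sym r_equiv j); have [_ ->] := r_equiv a b j.
  have /(_ c d cd) :=
    sync _ (@input_sum_admissible R n G k) _ (imageP _ x_diag).
  by rewrite !input_sum_indicator => /eqP; rewrite eqr_nat => /eqP.
move=> [fhat [FE fhat_inv]] _ [x x_diag <-] c d cd.
(* Matching along [q] keeps the arrow type, which makes the matching an input
   isomorphism, and the class of the tail, on which [x] is constant. *)
pose q e e' := @arrow_type n G e e' && r (tail e) (tail e').
have q_equiv : equivalence_rel q.
  move=> e e' e''; rewrite /q (arrow_type_equiv e'' e'' e'').1.
  rewrite (r_equiv (tail e'') (tail e'') (tail e'')).1; split=> // /andP[ae re].
  by rewrite (arrow_type_equiv e e' e'').2 // (r_equiv (tail e) (tail e') _).2.
have q_count c' k e : e \in (enum_val k : {set arrow G}) ->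
    #|[set a : input G c' | q e (val a)]| = #|class_inputs r k c' (tail e)|.
  move=> ek; rewrite -!sum1_card.
  under eq_bigl do rewrite inE.
  rewrite (big_input addn c' (q e) (fun=> 1%N)); apply: eq_bigl => e'.
  by rewrite inE (same_arrow_type _ ek) /q andbA.
have [|beta beta_bij beta_q] := @matching_of_equal_counts
  (input G c) (input G d) _ _ val val q_equiv.
  move=> e; have [k ek] := arrow_in_type e.
  by rewrite !(q_count _ k) //; apply: eq_count.
have beta_iso : input_isomorphism beta.
  by split=> // e; have /andP[] := beta_q e.
have cd_input : input_equiv G c d.
  rewrite /input_equiv; case: ifP => [/andP[/eqP c0 /eqP d0] | _].
    exact: r_source.
  by exists beta.
rewrite !FE (x_diag c d cd) -(fhat_inv c d beta) //; congr (fhat c _ _).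
apply/ffunP => e; rewrite !ffunE; apply: x_diag.
by have /andP[] := beta_q e.
Qed.
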